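(* Let $\nu>-1$ and $0<\alpha\le2$. There exist $T>0$ and a constant $C\ge1$ such that for all $x,y\in(0,1)$ and all $t\ge T$ $$C^{-1}(1-x)(1-y)\exp(-t\lambda_{1,\nu}^\alpha)\le G_t^{\nu,\alpha}(x,y)\le C(1-x)(1-y)\exp(-t\lambda_{1,\nu}^\alpha).$$ Moreover, the upper bound holds for an arbitrary fixed $T>0$; that is, for every $T>0$ there is a constant $C_T$ such that $G_t^{\nu,\alpha}(x,y)\le C_T(1-x)(1-y)\exp(-t\lambda_{1,\nu}^\alpha)$ for all $x,y\in(0,1)$ and $t\ge T$.
   Context: For $\nu>-1$, $J_\nu$ is the Bessel function of the first kind of order $\nu$, and $\lambda_{1,\nu}<\lambda_{2,\nu}<\dots$ are its successive positive zeros. The Fourier-Bessel functions on $(0,1)$ are $\phi_n^\nu(x)=d_{n,\nu}\,x^{-\nu-1/2}(\lambda_{n,\nu}x)^{1/2}J_\nu(\lambda_{n,\nu}x)$, $n\ge1$, with $d_{n,\nu}=\sqrt2\,|\lambda_{n,\nu}^{1/2}J_{\nu+1}(\lambda_{n,\nu})|^{-1}$; they form an orthonormal basis of $L^2((0,1),x^{2\nu+1}dx)$. For $\alpha\in(0,2]$, $$G_t^{\nu,\alpha}(x,y)=\sum_{n=1}^\infty \exp(-t\lambda_{n,\nu}^{\alpha})\,\phi_n^\nu(x)\phi_n^\nu(y),\qquad x,y\in(0,1),\ t>0.$$ *)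

(* Defs.v *)
From Stdlib Require Import Reals Factorial.
From Coquelicot Require Import Coquelicot.
Open Scope R_scope.

(* Euler's integral; meaningful for z > 0. *)
Definition Gamma (z : R) : R :=
  RInt_gen (fun s : R => Rpower s (z - 1) * exp (- s))
           (at_right 0) (Rbar_locally p_infty).

(* J_nu(x) for nu > -1 and x > 0: then every argument of Gamma is positive and
   [Rpower] is the genuine real power. *)
Definition BesselJ (nu x : R) : R :=
  Series (fun k : nat =>
    (-1) ^ k / (INR (fact k) * Gamma (INR k + nu + 1))
    * Rpower (x / 2) (2 * INR k + nu)).

(* [lambda nu n] is the n-th positive zero of J_nu for n >= 1; the value 0 at
   n = 0 only starts the recursion. The set of zeros beyond a given zero is
   nonempty and has a least element, so the infimum is the next zero. *)
Fixpoint lambda (nu : R) (n : nat) : R :=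
  match n with
  | O => 0
  | S m => real (Glb_Rbar (fun x : R => lambda nu m < x /\ BesselJ nu x = 0))
  end.

Definition dnorm (nu : R) (n : nat) : R :=
  sqrt 2 * / Rabs (sqrt (lambda nu n) * BesselJ (nu + 1) (lambda nu n)).

Definition phi (nu : R) (n : nat) (x : R) : R :=
  dnorm nu n * Rpower x (- nu - 1 / 2) * sqrt (lambda nu n * x)
  * BesselJ nu (lambda nu n * x).

(* [Series] sums from 0, whereas the eigenfunctions are indexed from 1. *)
Definition G (nu alpha t x y : R) : R :=
  Series (fun m : nat =>
    exp (- t * Rpower (lambda nu (S m)) alpha)
    * phi nu (S m) x * phi nu (S m) y).

(* Main.v *)
Require Import Defs.
From Stdlib Require Import Reals Lra Lia Factorial Classical.
From Coquelicot Require Import Coquelicot.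
Open Scope R_scope.

(** For large times the kernel is governed by its first term. With
    [b = clifford nu], the entire function such that
    [J_nu x = (x/2)^nu * b (x^2/4)], and [z_n = lambda_n^2 / 4], the eigenfunctions
    become
      [phi_n x = sqrt 2 * (2 / lambda_n) * b (z_n x^2) / |b' z_n|]
    ([phi_clifford]), and [b] solves [z b'' + (nu + 1) b' + b = 0] on the whole half
    line, including the singular point [0].

    The energy [z b'^2 + b^2] has derivative [- (2 nu + 1) b'^2], so away from
    [0] it grows and decays at most polynomially. This single fact bounds [b'] above on [0, z_n] and
    [b'] below at [z_n]. Since [b] vanishes at [z_n], the mean value theorem then gives
    [|phi_n x| <= K z_n^q (1 - x)] with [K] and [q] independent of [n] and [x]
    ([phi_bound]). For [n = 1] the derivative [b'] keeps its sign on [0, z_1], and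
    the same argument gives [phi_1 x >= k (1 - x)] ([phi_1_lower]).

    The zeros of [b] are infinitely many, by an oscillation argument for a Riccati
    equation ([clifford_zero_beyond]), and are separated by a fixed distance, again
    by the energy ([clifford_zeros_separated]). Hence the numbers [lambda_n] are
    indeed the successive zeros and [z_n] grows at least linearly ([lambda_spec],
    [lambda_growth]), which makes [sum z_n^q exp (- T lambda_n^alpha)] converge for
    every [T > 0] ([ex_series_weights]). The kernel, and its part beyond the first
    term, are therefore at most [(1 - x) (1 - y)] times a constant times
    [exp (- t lambda_1^alpha)], respectively [exp (- t lambda_2^alpha)], for
    [t >= T] ([kernel_tail_bound]). The first bound is the upper estimate; the
    second one shows that the first term dominates for large [t]. *)

(** * Calculus *)

Lemma ball_Rabs (x e y : R) : ball x e y <-> Rabs (y - x) < e.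
Proof. reflexivity. Qed.

Lemma mean_value (f df : R -> R) (a b : R) : a <= b ->
  (forall x, a <= x <= b -> is_derive f x (df x)) ->
  exists c, a <= c <= b /\ f b - f a = df c * (b - a).
Proof.
  intros hab hd.
  destruct (MVT_gen f a b df) as (c & hc & e).
  - intros x. rewrite Rmin_left, Rmax_right by lra. intros; apply hd; lra.
  - intros x. rewrite Rmin_left, Rmax_right by lra. intros hx.
    apply continuity_pt_filterlim, (ex_derive_continuous f). eexists; apply hd; lra.
  - rewrite Rmin_left, Rmax_right in hc by lra. now exists c.
Qed.

Lemma derive_nonneg_le (f df : R -> R) (a b : R) : a <= b ->
  (forall x, a <= x <= b -> is_derive f x (df x)) ->
  (forall x, a <= x <= b -> 0 <= df x) -> f a <= f b.
Proof.
  intros hab hd hp. destruct (mean_value f df a b hab hd) as (c & hc & e).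
  assert (h := hp c hc). nra.
Qed.

Lemma Rpower_pos (x p : R) : 0 < Rpower x p.
Proof. apply exp_pos. Qed.

Lemma is_derive_Rpower (x p : R) :
  0 < x -> is_derive (fun s => Rpower s p) x (p * Rpower x (p - 1)).
Proof.
  intros hx. apply is_derive_Reals. apply derivable_pt_lim_power. exact hx.
Qed.

Lemma continuous_Rpower (x p : R) : 0 < x -> continuous (fun s => Rpower s p) x.
Proof.
  intros hx. apply (ex_derive_continuous (fun s => Rpower s p)).
  eexists. apply is_derive_Rpower; exact hx.
Qed.

(** The maximum over [u] of [p u - q exp u], attained at [u = ln (p / q)]: the
    one inequality by which exponentials beat powers here, with [u = ln s] for
    Euler's integral and with [u = alpha ln l] for the heat factor. *)
Lemma mult_le_exp_shift (p q u : R) :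
  0 < p -> 0 < q -> p * u - q * exp u <= p * (ln (p / q) - 1).
Proof.
  intros hp hq.
  assert (hpq : 0 < p / q) by (apply Rdiv_lt_0_compat; lra).
  assert (h := exp_ineq1_le (u - ln (p / q))).
  assert (e : q * exp u = p * exp (u - ln (p / q))).
  { unfold Rminus. rewrite exp_plus, exp_Ropp, exp_ln by lra. field; lra. }
  rewrite e. nra.
Qed.

Lemma Rpower_exp_bounded (p : R) :
  0 < p -> exists K, 0 < K /\ forall s, 0 < s -> Rpower s p * exp (- s) <= K.
Proof.
  intros hp. exists (exp (p * (ln (p / 1) - 1))). split; [apply exp_pos|].
  intros s hs. unfold Rpower. rewrite <- exp_plus.
  assert (h := mult_le_exp_shift p 1 (ln s) hp Rlt_0_1).
  rewrite exp_ln in h by lra.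
  destruct (Req_dec (p * ln s + - s) (p * (ln (p / 1) - 1))) as [->|ne]; [lra|].
  left. apply exp_increasing. lra.
Qed.

(** * Euler's integral *)

(** For a nonnegative integrand the improper integral is the supremum of the
    proper ones, so boundedness is enough for convergence at both ends. *)
Lemma is_RInt_gen_nonneg_bounded (h : R -> R) (M : R) :
  (forall s, 0 < s -> continuous h s) ->
  (forall s, 0 < s -> 0 <= h s) ->
  (forall a b, 0 < a <= b -> RInt h a b <= M) ->
  exists l, is_RInt_gen h (at_right 0) (Rbar_locally p_infty) l /\
    forall a b, 0 < a <= b -> RInt h a b <= l.
Proof.
  intros hc hp hM.
  assert (hex : forall a b, 0 < a -> 0 < b -> ex_RInt h a b).
  { intros a b ha hb. apply (ex_RInt_continuous (V := R_CompleteNormedModule)). intros z [hz _]. apply hc.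
    apply Rlt_le_trans with (2 := hz). now apply Rmin_pos. }
  destruct (completeness (fun r => exists a b, 0 < a <= b /\ r = RInt h a b))
    as [l [hub hlub]].
  { exists M. intros r (a & b & hab & ->). now apply hM. }
  { exists (RInt h 1 1), 1, 1. split; [lra|reflexivity]. }
  exists l. split.
  2: { intros a b hab. apply hub. now exists a, b. }
  apply (proj2 (filterlimi_locally _ _)). intros eps.
  assert (hw : exists a b, 0 < a <= b /\ l - eps < RInt h a b).
  { apply NNPP. intros hn.
    assert (l <= l - eps); [|destruct eps; simpl in *; lra].
    apply hlub. intros r (a & b & hab & ->).
    apply Rnot_lt_le. intros hlt. apply hn. now exists a, b. }
  destruct hw as (a0 & b0 & hab & hlt).
  apply (Filter_prod _ _ _ (fun a => 0 < a < a0) (fun b => b0 < b)).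
  - exists (mkposreal a0 (proj1 hab)). intros a ha ha'.
    split; [exact ha'|]. apply (proj1 (ball_Rabs _ _ _)) in ha; simpl in ha. apply Rabs_lt_between in ha. lra.
  - now exists b0.
  - intros a b ha hb. exists (RInt h a b). simpl. split.
    + apply (RInt_correct h). apply hex; lra.
    + apply (proj2 (ball_Rabs _ _ _)).
      assert (h1 : RInt h a b <= l) by (apply hub; exists a, b; split; [lra|reflexivity]).
      assert (h2 : RInt h a0 b0 <= RInt h a b).
      { assert (e1 := RInt_Chasles h a a0 b (hex a a0 ltac:(lra) ltac:(lra)) (hex a0 b ltac:(lra) ltac:(lra))).
        assert (e2 := RInt_Chasles h a0 b0 b (hex a0 b0 ltac:(lra) ltac:(lra)) (hex b0 b ltac:(lra) ltac:(lra))).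
        unfold plus in e1, e2; simpl in e1, e2.
        assert (0 <= RInt h a a0).
        { apply RInt_ge_0; [lra|apply hex; lra|intros; apply hp; lra]. }
        assert (0 <= RInt h b0 b).
        { apply RInt_ge_0; [lra|apply hex; lra|intros; apply hp; lra]. }
        lra. }
      apply Rabs_lt_between. destruct eps; simpl in *; lra.
Qed.

Lemma continuous_Euler (z s : R) :
  0 < s -> continuous (fun s => Rpower s (z - 1) * exp (- s)) s.
Proof.
  intros hs. apply (continuous_mult (fun s => Rpower s (z-1)) (fun s => exp (- s))).
  - now apply continuous_Rpower.
  - apply (ex_derive_continuous (fun s => exp (- s))). auto_derive. exact I.
Qed.

(** The integrand is dominated by a multiple of [s^(z-1) / (1 + s^z)^2], whose
    primitive is bounded on the whole half line, so that both ends of Euler's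
    integral are controlled at once. *)
Lemma Euler_integral_bounded (z : R) :
  0 < z -> exists M, forall a b, 0 < a <= b ->
    RInt (fun s => Rpower s (z - 1) * exp (- s)) a b <= M.
Proof.
  intros hz.
  destruct (Rpower_exp_bounded (z + z) ltac:(lra)) as (K & hK & hb).
  (* since (1 + s^z)^2 <= 2 + 2 s^(2z) and exp (- s) <= 1 *)
  set (D := 2 + 2 * K).
  set (H := fun s => - (D / z) * / (1 + Rpower s z)).
  set (h := fun s => D * (Rpower s (z - 1) * / (1 + Rpower s z) ^ 2)).
  assert (hd : forall s, 0 < s -> is_derive H s (h s)).
  { intros s hs. unfold H, h.
    assert (hp := Rpower_pos s z).
    assert (d := is_derive_Rpower s z hs).
    evar_last.
    - apply is_derive_scal. apply is_derive_inv; [|lra].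
      apply (is_derive_plus (fun _ => 1) (fun s => Rpower s z)).
      apply is_derive_const. exact d.
    - unfold plus, zero; simpl. field. split; lra. }
  assert (hhc : forall s, 0 < s -> continuous h s).
  { intros s hs. unfold h. apply (continuous_mult (fun _ => D)).
    apply continuous_const.
    apply (continuous_mult (fun s => Rpower s (z-1)) (fun s => / (1 + Rpower s z)^2)).
    now apply continuous_Rpower.
    apply (ex_derive_continuous (fun s => / (1 + Rpower s z)^2)).
    assert (hp := Rpower_pos s z).
    eexists. apply is_derive_inv.
    apply is_derive_pow.
    apply (is_derive_plus (fun _ => 1) (fun s => Rpower s z)).
    apply is_derive_const. now apply is_derive_Rpower.
    apply pow_nonzero. lra. }
  exists (D / z). intros a b hab.
  assert (hi : is_RInt h a b (H b - H a)).
  { apply (is_RInt_derive (V := R_CompleteNormedModule) H h); intros x; rewrite Rmin_left, Rmax_right by lra; intros hx.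
    apply hd; lra. apply hhc; lra. }
  apply Rle_trans with (RInt h a b).
  - apply RInt_le; [lra| | |].
    + apply (ex_RInt_continuous (V := R_CompleteNormedModule)). intros x; rewrite Rmin_left, Rmax_right by lra; intros hx.
      apply continuous_Euler; lra.
    + eexists; exact hi.
    + intros s hs. unfold h.
      assert (hp := Rpower_pos s z). assert (hp1 := Rpower_pos s (z-1)).
      assert (hbs := hb s ltac:(lra)). rewrite Rpower_plus in hbs.
      assert (he : exp (- s) <= 1).
      { rewrite <- exp_0. left; apply exp_increasing; lra. }
      assert (he0 := exp_pos (- s)).
      set (w := Rpower s z) in *. set (e := exp (- s)) in *.
      assert (e <= D * / (1 + w)^2).
      { apply (Rmult_le_reg_r ((1 + w)^2)); [apply pow_lt; lra|].
        rewrite Rmult_assoc, Rinv_l by (apply pow_nonzero; lra).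
        assert (0 <= e * (1 - w) ^ 2) by (apply Rmult_le_pos; [lra|apply pow2_ge_0]).
        unfold D. nra. }
      rewrite <- Rmult_assoc, (Rmult_comm D), Rmult_assoc.
      apply Rmult_le_compat_l; lra.
  - rewrite (is_RInt_unique _ _ _ _ hi). unfold H.
    assert (hp := Rpower_pos a z). assert (hp1 := Rpower_pos b z).
    assert (0 < D / z) by (apply Rdiv_lt_0_compat; unfold D; lra).
    assert (0 < / (1 + Rpower b z)) by (apply Rinv_0_lt_compat; lra).
    assert (/ (1 + Rpower a z) <= 1).
    { rewrite <- Rinv_1. apply Rinv_le_contravar; lra. }
    nra.
Qed.

Lemma Gamma_spec (z : R) :
  0 < z ->
  is_RInt_gen (fun s => Rpower s (z - 1) * exp (- s))
    (at_right 0) (Rbar_locally p_infty) (Gamma z) /\ 0 < Gamma z.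
Proof.
  intros hz. destruct (Euler_integral_bounded z hz) as [M hM].
  destruct (is_RInt_gen_nonneg_bounded (fun s => Rpower s (z - 1) * exp (- s)) M)
    as (l & hl & hle).
  - intros s hs. now apply continuous_Euler.
  - intros s hs. apply Rmult_le_pos; left; apply exp_pos.
  - exact hM.
  - assert (e : Gamma z = l) by exact (is_RInt_gen_unique _ _ hl).
    rewrite e. split; [exact hl|].
    apply Rlt_le_trans with (2 := hle 1 2 ltac:(lra)).
    apply RInt_gt_0; [lra| |].
    + intros s _. apply Rmult_lt_0_compat; apply exp_pos.
    + intros s hs. apply continuous_Euler; lra.
Qed.

Lemma Gamma_pos (z : R) : 0 < z -> 0 < Gamma z.
Proof. intros hz. apply (Gamma_spec z hz). Qed.

(** Integration by parts: the boundary term [s^z exp (-s)] vanishes at both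
    ends. *)
Lemma Gamma_succ (z : R) : 0 < z -> Gamma (z + 1) = z * Gamma z.
Proof.
  intros hz.
  set (B := fun s => Rpower s z * exp (- s)).
  set (dB := fun s => z * (Rpower s (z - 1) * exp (- s)) - Rpower s (z + 1 - 1) * exp (- s)).
  assert (hd : forall s, 0 < s -> is_derive B s (dB s)).
  { intros s hs. evar_last.
    - apply (is_derive_mult (fun s => Rpower s z) (fun s => exp (- s))).
      now apply is_derive_Rpower.
      auto_derive; [exact I|reflexivity]. intros; apply Rmult_comm.
    - unfold dB, plus, mult; simpl. replace (z + 1 - 1) with z by ring. ring. }
  assert (h0 : filterlim B (at_right 0) (locally 0)).
  { apply (proj2 (filterlim_locally _ _)). intros eps.
    (* s^z < eps as soon as s < eps^(1/z) *)
    assert (he : 0 < exp (ln eps / z)) by apply exp_pos.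
    exists (mkposreal _ he). intros s hs hs'.
    apply (proj1 (ball_Rabs _ _ _)) in hs; simpl in hs. apply Rabs_lt_between in hs.
    assert (hp : 0 < Rpower s z) by apply exp_pos.
    assert (he1 := exp_pos (-s)).
    assert (he2 : exp (- s) < 1) by (rewrite <- exp_0; apply exp_increasing; lra).
    assert (Rpower s z < eps).
    { unfold Rpower. rewrite <- (exp_ln eps) by apply cond_pos.
      apply exp_increasing.
      assert (ln s < ln eps / z).
      { rewrite <- (ln_exp (ln eps / z)). apply ln_increasing; lra. }
      replace (ln eps) with (z * (ln eps / z)) by (field; lra).
      apply Rmult_lt_compat_l; lra. }
    apply (proj2 (ball_Rabs _ _ _)). unfold B. rewrite Rminus_0_r. apply Rabs_lt_between. nra. }
  assert (h1 : filterlim B (Rbar_locally p_infty) (locally 0)).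
  { apply (proj2 (filterlim_locally _ _)). intros eps.
    destruct (Rpower_exp_bounded (z + 1) ltac:(lra)) as (K & hK & hb).
    assert (hq : 0 < K / eps) by (apply Rdiv_lt_0_compat; [exact hK|apply cond_pos]).
    exists (K / eps). intros s hs.
    apply (proj2 (ball_Rabs _ _ _)).
    assert (hs0 : 0 < s) by lra.
    assert (hbs := hb s hs0). rewrite Rpower_plus, Rpower_1 in hbs by lra.
    assert (hB : 0 < B s) by (apply Rmult_lt_0_compat; apply exp_pos).
    assert (B s * s <= K) by (unfold B; lra).
    assert (K < eps * s).
    { replace K with (eps * (K / eps)).
      apply Rmult_lt_compat_l; [apply cond_pos|lra].
      field. apply Rgt_not_eq, cond_pos. }
    rewrite Rminus_0_r. apply Rabs_lt_between. destruct eps; simpl in *. nra. }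
  assert (pos : forall P : R -> Prop, (forall s, 0 < s -> P s) ->
    filter_prod (at_right 0) (Rbar_locally p_infty)
      (fun ab => forall x, Rmin (fst ab) (snd ab) <= x <= Rmax (fst ab) (snd ab) -> P x)).
  { intros P hP. apply (Filter_prod _ _ _ (fun a => 0 < a) (fun b => 0 < b)).
    - exists (mkposreal 1 Rlt_0_1). now intros.
    - now exists 0.
    - intros a b ha hb x hx. simpl in hx. apply hP.
      apply Rlt_le_trans with (Rmin a b); [now apply Rmin_pos|tauto]. }
  assert (hD : is_RInt_gen (Derive B) (at_right 0) (Rbar_locally p_infty) (0 - 0)).
  { apply is_RInt_gen_Derive; try assumption.
    - apply pos. intros s hs. eexists; now apply hd.
    - apply pos. intros s hs. apply continuous_ext_loc with dB.
      + exists (mkposreal s hs). intros y hy.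
        symmetry. apply is_derive_unique, hd.
        apply (proj1 (ball_Rabs _ _ _)) in hy; simpl in hy; apply Rabs_lt_between in hy; lra.
      + apply (continuous_minus (fun s => z * (Rpower s (z - 1) * exp (- s))) (fun s => Rpower s (z + 1 - 1) * exp (- s))).
        apply (continuous_mult (fun _ => z)). apply continuous_const.
        now apply continuous_Euler. apply (continuous_Euler (z + 1)). exact hs. }
  destruct (Gamma_spec z hz) as [g0 _].
  destruct (Gamma_spec (z + 1) ltac:(lra)) as [g1 _].
  assert (g2 := is_RInt_gen_minus _ _ _ _ (is_RInt_gen_scal _ z _ g0) g1).
  assert (g3 : is_RInt_gen dB (at_right 0) (Rbar_locally p_infty) (0 - 0)).
  { apply is_RInt_gen_ext with (2 := hD).
    generalize (pos (fun s => Derive B s = dB s)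
      (fun s hs => is_derive_unique _ _ _ (hd s hs))).
    apply filter_imp. intros ab hab x hx. apply hab. lra. }
  assert (e1 := is_RInt_gen_unique _ _ g3).
  assert (e2 := is_RInt_gen_unique _ _ g2).
  unfold dB in e1. unfold minus, plus, scal, opp in e2; simpl in e2; unfold mult in e2; simpl in e2.
  unfold Rminus in e1 at 1. rewrite e1 in e2. lra.
Qed.

(** * The Bessel-Clifford function *)

Definition clifford_coef (nu : R) (k : nat) : R :=
  (-1) ^ k / (INR (fact k) * Gamma (INR k + nu + 1)).

(** The Bessel-Clifford function at [-z]: what is left of [J_nu x] with
    [z = x^2/4] when the factor [(x/2)^nu] is taken out. *)
Definition clifford (nu z : R) : R := PSeries (clifford_coef nu) z.

Lemma clifford_coef_nonzero (nu : R) (k : nat) : -1 < nu -> clifford_coef nu k <> 0.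
Proof.
  intros hnu. unfold clifford_coef.
  assert (h := pos_INR k). assert (hG := Gamma_pos (INR k + nu + 1) ltac:(lra)).
  assert (hf := INR_fact_lt_0 k).
  apply Rmult_integral_contrapositive_currified.
  apply pow_nonzero; lra.
  apply Rinv_neq_0_compat. apply Rgt_not_eq. now apply Rmult_lt_0_compat.
Qed.

(** The functional equation of [Gamma] makes the coefficients hypergeometric;
    this recurrence is Bessel's equation on the level of power series. *)
Lemma clifford_coef_step (nu : R) (k : nat) : -1 < nu ->
  clifford_coef nu (S k) * (INR (S k) * (INR (S k) + nu)) = - clifford_coef nu k.
Proof.
  intros hnu. unfold clifford_coef.
  assert (h := pos_INR k). assert (hG := Gamma_pos (INR k + nu + 1) ltac:(lra)).
  assert (hf := INR_fact_lt_0 k).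
  assert (e : Gamma (INR (S k) + nu + 1) = (INR k + nu + 1) * Gamma (INR k + nu + 1)).
  { rewrite <- Gamma_succ by lra. f_equal. rewrite S_INR. ring. }
  rewrite e. rewrite fact_simpl, mult_INR, S_INR. simpl pow.
  field. repeat split; lra.
Qed.

Lemma clifford_coef_derive (nu : R) (k : nat) : -1 < nu ->
  PS_derive (clifford_coef nu) k = - clifford_coef (nu + 1) k.
Proof.
  intros hnu. unfold PS_derive, clifford_coef.
  assert (h := pos_INR k). assert (hf := INR_fact_lt_0 k).
  assert (hG := Gamma_pos (INR k + (nu + 1) + 1) ltac:(lra)).
  replace (INR (S k) + nu + 1) with (INR k + (nu + 1) + 1) by (rewrite S_INR; ring).
  rewrite fact_simpl, mult_INR, S_INR. simpl pow.
  field. repeat split; lra.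
Qed.

Lemma clifford_radius (nu : R) : -1 < nu -> CV_radius (clifford_coef nu) = p_infty.
Proof.
  intros hnu. apply CV_radius_infinite_DAlembert.
  { intros n. now apply clifford_coef_nonzero. }
  apply is_lim_seq_le_le with (u := fun _ => 0) (w := fun n => / (nu + 1) * / (INR n + 1)).
  - intros n. split; [apply Rabs_pos|].
    assert (h := pos_INR n).
    assert (hs := clifford_coef_step nu n hnu). rewrite S_INR in hs.
    assert (h0 := clifford_coef_nonzero nu n hnu).
    replace (clifford_coef nu (S n) / clifford_coef nu n)
      with (- / ((INR n + 1) * (INR n + 1 + nu))).
    2: { apply (Rmult_eq_reg_r (clifford_coef nu n * ((INR n + 1) * (INR n + 1 + nu)))).
      - replace (clifford_coef nu (S n) / clifford_coef nu n * (clifford_coef nu n * ((INR n + 1) * (INR n + 1 + nu))))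
          with (clifford_coef nu (S n) * ((INR n + 1) * (INR n + 1 + nu))) by (field; lra).
        rewrite hs. field. split; lra.
      - apply Rmult_integral_contrapositive_currified; [exact h0|].
        apply Rgt_not_eq, Rmult_lt_0_compat; lra. }
    rewrite Rabs_Ropp, Rabs_pos_eq, <- Rinv_mult.
    2: { left. apply Rinv_0_lt_compat, Rmult_lt_0_compat; lra. }
    apply Rinv_le_contravar; [apply Rmult_lt_0_compat; lra|nra].
  - apply is_lim_seq_const.
  - replace (Finite 0) with (Rbar_mult (/ (nu + 1)) 0) by (simpl; f_equal; ring).
    apply is_lim_seq_scal_l.
    apply is_lim_seq_ext with (u := fun n => / INR (S n)).
    { intros n. now rewrite S_INR. }
    apply (is_lim_seq_incr_1 (fun n => / INR n)).
    change (Finite 0) with (Rbar_inv p_infty).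
    apply is_lim_seq_inv; [apply is_lim_seq_INR|discriminate].
Qed.

Lemma clifford_derive (nu z : R) : -1 < nu ->
  is_derive (clifford nu) z (- clifford (nu + 1) z).
Proof.
  intros hnu. unfold clifford. evar_last.
  - apply is_derive_PSeries. rewrite clifford_radius by exact hnu. exact I.
  - rewrite (PSeries_ext _ (PS_opp (clifford_coef (nu + 1)))).
    apply PSeries_opp. intros n. unfold PS_opp, opp; simpl. now apply clifford_coef_derive.
Qed.

(** Together with [clifford_derive] this is Bessel's equation, written as a
    first order system for [b = clifford nu] and [c = clifford (nu + 1)]:
    [b' = - c] and [z c' = b - (nu + 1) c]. The second equation is the
    contiguity relation between the orders [nu], [nu + 1] and [nu + 2]. *)
Lemma clifford_succ_derive (nu z : R) : -1 < nu -> 0 < z ->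
  is_derive (clifford (nu + 1)) z ((clifford nu z - (nu + 1) * clifford (nu + 1) z) / z).
Proof.
  intros hnu hz. evar_last. apply clifford_derive; lra.
  assert (hex : forall mu, -1 < mu -> ex_pseries (clifford_coef mu) z).
  { intros mu hmu. apply CV_radius_inside. rewrite clifford_radius by exact hmu. exact I. }
  apply (Rmult_eq_reg_l (- z)); [|lra].
  replace (- z * ((clifford nu z - (nu + 1) * clifford (nu + 1) z) / z))
    with ((nu + 1) * clifford (nu + 1) z - clifford nu z) by (field; lra).
  replace (- z * - clifford (nu + 1 + 1) z) with (z * clifford (nu + 1 + 1) z) by ring.
  unfold clifford. rewrite <- PSeries_incr_1, <- PSeries_scal, <- PSeries_minus.
  - apply PSeries_ext. intros n. unfold PS_incr_1, PS_minus, PS_plus, PS_opp, PS_scal, scal, plus, opp; simpl.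
    unfold mult; simpl.
    assert (h := pos_INR n).
    assert (e := clifford_coef_step nu n hnu).
    assert (e1 := clifford_coef_derive nu n hnu). unfold PS_derive in e1.
    rewrite S_INR in e, e1.
    assert (e3 : clifford_coef nu n = (INR n + 1 + nu) * clifford_coef (nu + 1) n) by nra.
    destruct n as [|n].
    + change (@zero R_NormedModule) with 0. simpl INR in *. lra.
    + assert (e2 := clifford_coef_derive (nu + 1) n ltac:(lra)). unfold PS_derive in e2.
      rewrite S_INR in *. nra.
  - apply ex_pseries_scal. apply Rmult_comm. apply hex; lra.
  - apply hex; lra.
Qed.

Lemma clifford_0_pos (nu : R) : -1 < nu -> 0 < clifford nu 0.
Proof.
  intros hnu. unfold clifford. rewrite PSeries_0. unfold clifford_coef. simpl.
  assert (hG := Gamma_pos (0 + nu + 1) ltac:(lra)).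
  apply Rdiv_lt_0_compat; lra.
Qed.

Lemma BesselJ_clifford (nu x : R) : 0 < x ->
  BesselJ nu x = Rpower (x / 2) nu * clifford nu (x ^ 2 / 4).
Proof.
  intros hx. unfold BesselJ, clifford, PSeries. rewrite <- Series_scal_l.
  apply Series_ext. intros k. fold (clifford_coef nu k).
  rewrite Rpower_plus.
  replace (2 * INR k) with (INR (2 * k)) by (rewrite mult_INR; simpl; ring).
  rewrite Rpower_pow by lra. rewrite pow_mult.
  replace ((x / 2) ^ 2) with (x ^ 2 / 4) by field. ring.
Qed.

Lemma clifford_continuous (nu z : R) : -1 < nu -> continuous (clifford nu) z.
Proof.
  intros hnu. apply (ex_derive_continuous (clifford nu)).
  eexists; now apply clifford_derive.
Qed.

(** * Energy estimates *)

(** In the variable [x] with [z = x^2/4] this is the sum of the squares of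
    [u = x^(-nu) J_nu x] and [u'], up to a constant. *)
Definition energy (nu z : R) : R := z * clifford (nu + 1) z ^ 2 + clifford nu z ^ 2.

Lemma energy_derive (nu z : R) : -1 < nu -> 0 < z ->
  is_derive (energy nu) z (- (2 * nu + 1) * clifford (nu + 1) z ^ 2).
Proof.
  intros hnu hz. unfold energy. evar_last.
  - apply (is_derive_plus (fun z => z * clifford (nu + 1) z ^ 2) (fun z => clifford nu z ^ 2)).
    + apply (is_derive_mult (fun z => z) (fun z => clifford (nu + 1) z ^ 2)).
      apply is_derive_id. apply is_derive_pow. now apply clifford_succ_derive.
      intros; apply Rmult_comm.
    + apply is_derive_pow. now apply clifford_derive.
  - unfold plus, mult, one; simpl. field. lra.
Qed.

Lemma energy_ge (nu z : R) : 0 < z ->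
  z * clifford (nu + 1) z ^ 2 <= energy nu z /\ clifford nu z ^ 2 <= energy nu z.
Proof.
  intros hz. unfold energy.
  assert (h1 := pow2_ge_0 (clifford nu z)). assert (h2 := pow2_ge_0 (clifford (nu + 1) z)).
  nra.
Qed.

(** In absolute value the derivative of the energy is at most [|2 nu + 1| / z]
    times the energy, so
    over [a <= z] the energy changes by at most a power of [z / a], in either
    direction; [energy_le_mul_pow] is the other direction. An integer exponent
    makes real powers avoidable. *)
Lemma energy_mul_pow_le (nu : R) (p : nat) (a z : R) : -1 < nu ->
  Rabs (2 * nu + 1) <= INR (S p) -> 0 < a <= z ->
  energy nu a * a ^ S p <= energy nu z * z ^ S p.
Proof.
  intros hnu hp haz. apply Rabs_le_between in hp.
  apply (derive_nonneg_le (fun z => energy nu z * z ^ S p)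
    (fun z => - (2 * nu + 1) * clifford (nu + 1) z ^ 2 * z ^ S p
      + energy nu z * (INR (S p) * 1 * z ^ p))); [lra| |].
  - intros x hx. apply (is_derive_mult (energy nu) (fun z => z ^ S p)).
    apply energy_derive; lra.
    apply (is_derive_pow (fun z => z)). exact (is_derive_id x).
    intros; apply Rmult_comm.
  - intros x hx. destruct (energy_ge nu x ltac:(lra)) as [h1 _].
    assert (h2 := pow2_ge_0 (clifford (nu + 1) x)).
    assert (0 <= x ^ p) by (apply pow_le; lra).
    replace (- (2 * nu + 1) * clifford (nu + 1) x ^ 2 * x ^ S p
      + energy nu x * (INR (S p) * 1 * x ^ p))
      with (x ^ p * (INR (S p) * energy nu x - (2 * nu + 1) * (x * clifford (nu + 1) x ^ 2)))
      by (simpl; ring).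
    apply Rmult_le_pos; [lra|].
    assert (0 <= x * clifford (nu + 1) x ^ 2) by (apply Rmult_le_pos; lra).
    nra.
Qed.

Lemma energy_le_mul_pow (nu : R) (p : nat) (a z : R) : -1 < nu ->
  Rabs (2 * nu + 1) <= INR (S p) -> 0 < a <= z ->
  energy nu z * a ^ S p <= energy nu a * z ^ S p.
Proof.
  intros hnu hp haz. apply Rabs_le_between in hp.
  assert (h : - (energy nu a * / a ^ S p) <= - (energy nu z * / z ^ S p)).
  { apply (derive_nonneg_le (fun z => - (energy nu z * / z ^ S p))
    (fun z => - (- (2 * nu + 1) * clifford (nu + 1) z ^ 2 * / z ^ S p
      + energy nu z * (- (INR (S p) * 1 * z ^ p) / (z ^ S p) ^ 2)))); [lra| |].
  - intros x hx. apply (is_derive_opp (fun z => energy nu z * / z ^ S p)).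
    apply (is_derive_mult (energy nu) (fun z => / z ^ S p)).
    apply energy_derive; lra.
    apply is_derive_inv. apply (is_derive_pow (fun z => z)). exact (is_derive_id x).
    apply pow_nonzero; lra.
    intros; apply Rmult_comm.
  - intros x hx. destruct (energy_ge nu x ltac:(lra)) as [h1 _].
    assert (h2 := pow2_ge_0 (clifford (nu + 1) x)).
    assert (hxp : 0 < x ^ p) by (apply pow_lt; lra).
    replace (- (- (2 * nu + 1) * clifford (nu + 1) x ^ 2 * / x ^ S p
      + energy nu x * (- (INR (S p) * 1 * x ^ p) / (x ^ S p) ^ 2)))
      with (/ (x ^ S p * x) * (INR (S p) * energy nu x + (2 * nu + 1) * (x * clifford (nu + 1) x ^ 2))).
    2: { change (x ^ S p) with (x * x ^ p). field. lra. }
    apply Rmult_le_pos.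
    { left. apply Rinv_0_lt_compat. apply Rmult_lt_0_compat; [apply pow_lt|]; lra. }
    assert (0 <= x * clifford (nu + 1) x ^ 2) by (apply Rmult_le_pos; lra).
    nra. }
  assert (ha : 0 < a ^ S p) by (apply pow_lt; lra).
  assert (hz : 0 < z ^ S p) by (apply pow_lt; lra).
  apply (Rmult_le_reg_r (/ a ^ S p * / z ^ S p)).
  { apply Rmult_lt_0_compat; now apply Rinv_0_lt_compat. }
  replace (energy nu z * a ^ S p * (/ a ^ S p * / z ^ S p)) with (energy nu z * / z ^ S p) by (field; lra).
  replace (energy nu a * z ^ S p * (/ a ^ S p * / z ^ S p)) with (energy nu a * / a ^ S p) by (field; lra).
  lra.
Qed.

Lemma clifford_positive_near_0 (nu : R) : -1 < nu ->
  exists d, 0 < d /\ forall z, 0 <= z <= d -> 0 < clifford nu z.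
Proof.
  intros hnu. assert (h0 := clifford_0_pos nu hnu).
  destruct (proj1 (filterlim_locally _ _) (clifford_continuous nu 0 hnu) (mkposreal _ h0)) as [d hd].
  exists (d / 2). assert (hdp := cond_pos d). split; [lra|].
  intros z hz. assert (hb : ball (clifford nu 0) (clifford nu 0) (clifford nu z)).
  { apply hd. apply (proj2 (ball_Rabs _ _ _)).
    apply Rabs_lt_between; lra. }
  apply (proj1 (ball_Rabs _ _ _)) in hb; simpl in hb; apply Rabs_lt_between in hb; lra.
Qed.

Lemma energy_exponent (nu : R) : exists p, Rabs (2 * nu + 1) <= INR (S p).
Proof.
  destruct (nfloor_ex (Rabs (2 * nu + 1)) (Rabs_pos _)) as [p hp].
  exists p. rewrite S_INR. lra.
Qed.

(** Energy cannot vanish once it is positive, and it is positive near [0]. At a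
    zero of [clifford nu] this says that the zero is simple. *)
Lemma energy_pos (nu z : R) : -1 < nu -> 0 < z -> 0 < energy nu z.
Proof.
  intros hnu hz. destruct (energy_exponent nu) as [p hp].
  destruct (clifford_positive_near_0 nu hnu) as (d & hd & hpos).
  set (a := Rmin d z).
  assert (h1 : a <= d) by apply Rmin_l. assert (h2 : a <= z) by apply Rmin_r.
  assert (ha : 0 < a) by (apply Rmin_pos; lra).
  assert (h := energy_mul_pow_le nu p a z hnu hp ltac:(lra)).
  destruct (energy_ge nu a ha) as [_ h'].
  assert (hb : 0 < clifford nu a ^ 2) by (apply pow_lt, hpos; lra).
  assert (0 < a ^ S p) by (apply pow_lt; lra).
  assert (0 < z ^ S p) by (apply pow_lt; lra). nra.
Qed.

(** * Oscillation and spacing of the zeros *)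

(** Oscillation. As long as [b = clifford nu] has no zero, with
    [c = clifford (nu + 1)] the function [sg = z c / b - nu / 2] satisfies the
    Riccati equation [sg' = 1 + (sg^2 - nu^2 / 4) / z]. On [A1 <= z <= B] with
    [nu^2 / 2 <= A1] and [k^2 B = 2] this gives [(atan (k sg))' >= k / 2], so
    that [atan] would increase by [k (B - A1) / 2], which is more than [PI] when
    [k] is small. *)
Lemma clifford_zero_beyond (nu A : R) : -1 < nu -> exists z, A < z /\ clifford nu z = 0.
Proof.
  intros hnu. apply NNPP. intros hn.
  set (A1 := Rmax A (nu ^ 2 / 2) + 1).
  assert (hA : A < A1) by (unfold A1; assert (h := Rmax_l A (nu ^ 2 / 2)); lra).
  assert (hA1 : nu ^ 2 / 2 + 1 <= A1) by (unfold A1; assert (h := Rmax_r A (nu ^ 2 / 2)); lra).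
  assert (hsq := pow2_ge_0 nu).
  (* any k with 1 / k - k A1 / 2 >= 4 >= PI will do *)
  set (k := / (5 + A1)). set (B := 2 * (5 + A1) ^ 2).
  assert (hk : 0 < k) by (apply Rinv_0_lt_compat; lra).
  assert (hkB : k ^ 2 * B = 2) by (unfold k, B; field; lra).
  assert (hAB : A1 <= B) by (unfold B; nra).
  set (sg := fun z => z * clifford (nu + 1) z / clifford nu z - nu / 2).
  set (dsg := fun z => 1 + (sg z ^ 2 - nu ^ 2 / 4) / z).
  assert (hb : forall z, A1 <= z <= B -> clifford nu z <> 0).
  { intros z hz e. apply hn. exists z. split; [lra|exact e]. }
  assert (hd : forall z, A1 <= z <= B -> is_derive sg z (dsg z)).
  { intros z hz. assert (hbz := hb z hz). unfold sg. evar_last.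
    - apply (is_derive_minus (fun z => z * clifford (nu + 1) z / clifford nu z) (fun _ => nu / 2)).
      apply is_derive_div.
      apply (is_derive_mult (fun z => z) (clifford (nu + 1))).
      apply is_derive_id. apply clifford_succ_derive; lra. intros; apply Rmult_comm.
      now apply clifford_derive. exact hbz. apply is_derive_const.
    - unfold dsg, sg, minus, plus, opp, mult, one, zero; simpl. field. split; [exact hbz|lra]. }
  assert (hm : atan (k * sg A1) - k / 2 * A1 <= atan (k * sg B) - k / 2 * B).
  { apply (derive_nonneg_le (fun z => atan (k * sg z) - k / 2 * z)
      (fun z => k * dsg z * / (1 + Rsqr (k * sg z)) - k / 2)); [lra| |].
    - intros z hz. evar_last.
      apply (is_derive_minus (fun z => atan (k * sg z)) (fun z => k / 2 * z)).
      apply (is_derive_comp atan (fun z => k * sg z)).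
      apply is_derive_atan. apply is_derive_scal. now apply hd.
      apply is_derive_scal. apply is_derive_id.
      unfold minus, plus, opp, scal, mult, one; simpl; unfold mult; simpl. ring.
    - intros z hz.
      assert (hs : 1 / 2 + sg z ^ 2 * (k ^ 2 / 2) <= dsg z).
      { unfold dsg.
        assert (h1 := pow2_ge_0 (sg z)).
        apply (Rmult_le_reg_r z); [lra|].
        replace ((1 + (sg z ^ 2 - nu ^ 2 / 4) / z) * z) with (z + sg z ^ 2 - nu ^ 2 / 4) by (field; lra).
        assert (k ^ 2 * z <= 2).
        { rewrite <- hkB. apply Rmult_le_compat_l; [apply pow2_ge_0|lra]. }
        nra. }
      unfold Rsqr.
      assert (hq : 0 < 1 + k * sg z * (k * sg z)) by nra.
      apply (Rmult_le_reg_r (1 + k * sg z * (k * sg z))); [exact hq|].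
      rewrite Rmult_0_l, Rmult_minus_distr_r, Rmult_assoc, Rinv_l by lra.
      assert (k * (1 / 2 + sg z ^ 2 * (k ^ 2 / 2)) <= k * dsg z)
        by (apply Rmult_le_compat_l; lra).
      nra. }
  assert (b1 := atan_bound (k * sg A1)). assert (b2 := atan_bound (k * sg B)).
  assert (hpi := PI_4).
  assert (e1 : k * (5 + A1) = 1) by (unfold k; field; lra).
  assert (e2 : k * B = 2 * (5 + A1)) by (unfold B, k; field; lra).
  nra.
Qed.

(** Spacing. Between two zeros [u < v] of [clifford nu] its derivative
    [- clifford (nu + 1)] has a zero [w]. On the other hand the energy at [u] is
    [u * clifford (nu + 1) u ^ 2], and it controls the energy on [u, 2u], hence
    the derivative of [clifford (nu + 1)] there, by a multiple of
    [clifford (nu + 1) u]. So [clifford (nu + 1)] cannot reach [0] too soon. *)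
Lemma clifford_zeros_separated (nu d : R) : -1 < nu -> 0 < d ->
  exists r, 0 < r /\ forall u v, d <= u -> u < v ->
    clifford nu u = 0 -> clifford nu v = 0 -> r <= v - u.
Proof.
  intros hnu hd.
  destruct (energy_exponent nu) as [p hp'].
  set (Q := (2 + 2 * (nu + 1) ^ 2 / d) * 2 ^ S p / d).
  assert (h2p : 0 < 2 ^ S p) by (apply pow_lt; lra).
  assert (hn2 := pow2_ge_0 (nu + 1)).
  assert (hc0 : 0 <= 2 * (nu + 1) ^ 2 / d) by (apply Rdiv_le_0_compat; lra).
  assert (hQ : 0 < Q).
  { apply Rdiv_lt_0_compat; [|exact hd]. apply Rmult_lt_0_compat; lra. }
  exists (Rmin d (sqrt (/ Q))). split.
  { apply Rmin_pos; [exact hd|]. apply sqrt_lt_R0. now apply Rinv_0_lt_compat. }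
  intros u v hu huv zu zv.
  (* when v - u < d <= u, the interval lies in [u, 2u] *)
  destruct (Rle_lt_dec d (v - u)) as [hbig|hsmall].
  { apply Rle_trans with (2 := hbig). apply Rmin_l. }
  apply Rle_trans with (1 := Rmin_r _ _).
  destruct (mean_value (clifford nu) (fun z => - clifford (nu + 1) z) u v) as (w & hw & ew).
  { lra. } { intros; now apply clifford_derive. }
  assert (cw : clifford (nu + 1) w = 0) by nra.
  destruct (mean_value (clifford (nu + 1))
    (fun z => (clifford nu z - (nu + 1) * clifford (nu + 1) z) / z) u w) as (x & hx & ex).
  { lra. } { intros; apply clifford_succ_derive; lra. }
  rewrite cw in ex.
  set (cu := clifford (nu + 1) u) in *.
  assert (hF : energy nu x * u ^ S p <= u * cu ^ 2 * (2 ^ S p * u ^ S p)).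
  { apply Rle_trans with (energy nu u * x ^ S p).
    - apply energy_le_mul_pow; try assumption; lra.
    - rewrite <- Rpow_mult_distr.
      replace (energy nu u) with (u * cu ^ 2) by (unfold energy, cu; rewrite zu; simpl; ring).
      apply Rmult_le_compat_l.
      { apply Rmult_le_pos; [lra|apply pow2_ge_0]. }
      apply pow_incr; lra. }
  assert (hup : 0 < u ^ S p) by (apply pow_lt; lra).
  assert (hF' : energy nu x <= u * cu ^ 2 * 2 ^ S p).
  { apply (Rmult_le_reg_r (u ^ S p)); [exact hup|]. lra. }
  destruct (energy_ge nu x ltac:(lra)) as [g1 g2].
  set (bx := clifford nu x) in *. set (cx := clifford (nu + 1) x) in *.
  assert (hE0 : 0 <= energy nu x) by (assert (h := pow2_ge_0 bx); lra).
  assert (g3 : (bx - (nu + 1) * cx) ^ 2 <= (2 + 2 * (nu + 1) ^ 2 / d) * energy nu x).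
  { assert (hcx : cx ^ 2 <= energy nu x / d).
    { apply (Rmult_le_reg_l d); [exact hd|].
      replace (d * (energy nu x / d)) with (energy nu x) by (field; lra).
      assert (h := pow2_ge_0 cx). nra. }
    assert (hs : (bx - (nu + 1) * cx) ^ 2 <= 2 * bx ^ 2 + 2 * ((nu + 1) ^ 2 * cx ^ 2)).
    { assert (h := pow2_ge_0 (bx + (nu + 1) * cx)). nra. }
    assert (hm : (nu + 1) ^ 2 * cx ^ 2 <= (nu + 1) ^ 2 * (energy nu x / d))
      by (apply Rmult_le_compat_l; assumption).
    replace ((2 + 2 * (nu + 1) ^ 2 / d) * energy nu x)
      with (2 * energy nu x + 2 * ((nu + 1) ^ 2 * (energy nu x / d))) by (field; lra).
    lra. }
  assert (g4 : (bx - (nu + 1) * cx) ^ 2 <= Q * d * (u * cu ^ 2)).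
  { apply Rle_trans with (1 := g3).
    replace (Q * d * (u * cu ^ 2)) with ((2 + 2 * (nu + 1) ^ 2 / d) * (u * cu ^ 2 * 2 ^ S p))
      by (unfold Q; field; lra).
    apply Rmult_le_compat_l; lra. }
  assert (hcu : 0 < cu ^ 2).
  { destruct (Req_dec cu 0) as [e|ne].
    - exfalso.
      assert (hF0 : energy nu u = 0) by (unfold energy; fold cu; rewrite zu, e; simpl; ring).
      assert (h := energy_pos nu u hnu ltac:(lra)). lra.
    - apply pow2_gt_0; exact ne. }
  assert (g5 : cu ^ 2 * x ^ 2 = (bx - (nu + 1) * cx) ^ 2 * (w - u) ^ 2).
  { replace cu with (- ((bx - (nu + 1) * cx) / x * (w - u))) by lra. field. lra. }
  assert (g6 : / Q <= (v - u) ^ 2).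
  { apply (Rmult_le_reg_l Q); [exact hQ|]. rewrite Rinv_r by lra.
    assert (hwv : (w - u) ^ 2 <= (v - u) ^ 2) by (apply pow_incr; lra).
    assert (hw0 := pow2_ge_0 (w - u)).
    assert (i1 : cu ^ 2 * x ^ 2 <= Q * d * (u * cu ^ 2) * (w - u) ^ 2).
    { rewrite g5. apply Rmult_le_compat_r; assumption. }
    assert (i2 : d * u <= x ^ 2) by nra.
    assert (i3 : cu ^ 2 * (d * u) <= cu ^ 2 * (d * u) * (Q * (w - u) ^ 2)).
    { apply Rle_trans with (cu ^ 2 * x ^ 2); [apply Rmult_le_compat_l; lra|]. lra. }
    assert (i4 : 0 < cu ^ 2 * (d * u)).
    { apply Rmult_lt_0_compat; [exact hcu|]. apply Rmult_lt_0_compat; lra. }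
    assert (1 <= Q * (w - u) ^ 2).
    { apply (Rmult_le_reg_l (cu ^ 2 * (d * u))); [exact i4|]. lra. }
    apply Rle_trans with (Q * (w - u) ^ 2); [lra|]. apply Rmult_le_compat_l; lra. }
  rewrite <- (sqrt_pow2 (v - u)) by lra. now apply sqrt_le_1_alt.
Qed.

(** * The sequence of zeros *)

Lemma BesselJ_eq_0 (nu x : R) : 0 < x ->
  (BesselJ nu x = 0 <-> clifford nu (x ^ 2 / 4) = 0).
Proof.
  intros hx. rewrite BesselJ_clifford by exact hx.
  assert (h := Rpower_pos (x / 2) nu). split.
  - intros e. apply Rmult_integral in e. destruct e; [lra|assumption].
  - intros ->. ring.
Qed.

(** The first gap, between [0] and the zeros, has to be treated apart, as [0] is
    not a zero although it starts the recursion for [lambda]. *)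
Lemma clifford_zeros_gap (nu : R) : -1 < nu -> exists r, 0 < r /\
  (forall v, 0 <= v -> clifford nu v = 0 -> r <= v) /\
  (forall u v, 0 <= u < v -> clifford nu u = 0 -> clifford nu v = 0 -> u + r <= v).
Proof.
  intros hnu.
  destruct (clifford_positive_near_0 nu hnu) as (d & hd & hpos).
  assert (hzd : forall v, 0 <= v -> clifford nu v = 0 -> d <= v).
  { intros v hv e. apply Rnot_lt_le. intros hlt. assert (h := hpos v ltac:(lra)). lra. }
  destruct (clifford_zeros_separated nu d hnu hd) as (r & hr & hsep).
  exists (Rmin d r). assert (h1 := Rmin_l d r). assert (h2 := Rmin_r d r).
  split; [now apply Rmin_pos|]. split.
  - intros v hv e. assert (h := hzd v hv e). lra.
  - intros u v huv eu ev. assert (h := hsep u v (hzd u (proj1 huv) eu) (proj2 huv) eu ev). lra.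
Qed.

Lemma two_sqrt_sq (w : R) : 0 <= w -> (2 * sqrt w) ^ 2 / 4 = w.
Proof.
  intros hw. replace ((2 * sqrt w) ^ 2 / 4) with (sqrt w ^ 2) by field.
  now apply pow2_sqrt.
Qed.

Lemma lt_two_sqrt (l w : R) : 0 <= l -> l ^ 2 / 4 < w -> l < 2 * sqrt w.
Proof.
  intros hl hw. assert (h := pow2_ge_0 l).
  apply Rnot_le_lt. intros hle. assert (hs := sqrt_pos w).
  assert (h2 : (2 * sqrt w) ^ 2 <= l ^ 2) by (apply pow_incr; lra).
  assert (h3 := two_sqrt_sq w ltac:(lra)). lra.
Qed.

(** One step of the recursion defining [lambda]. The set whose infimum is taken is
    nonempty because of oscillation; the infimum is a zero by continuity, and it
    exceeds [l] because the zeros beyond [l] keep a distance from it. *)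
Lemma next_zero_spec (nu r l : R) : -1 < nu -> 0 < r -> 0 <= l ->
  (forall x, l < x -> clifford nu (x ^ 2 / 4) = 0 -> l ^ 2 / 4 + r <= x ^ 2 / 4) ->
  let L := real (Glb_Rbar (fun x : R => l < x /\ BesselJ nu x = 0)) in
  l < L /\ clifford nu (L ^ 2 / 4) = 0 /\ l ^ 2 / 4 + r <= L ^ 2 / 4 /\
  (forall x, l < x < L -> clifford nu (x ^ 2 / 4) <> 0).
Proof.
  intros hnu hr hl hgap L.
  set (E := fun x : R => l < x /\ BesselJ nu x = 0) in *.
  assert (hE : forall x, E x <-> l < x /\ clifford nu (x ^ 2 / 4) = 0).
  { intros x. unfold E. split; intros [h1 h2]; split; try exact h1;
      apply (BesselJ_eq_0 nu x); lra. }
  destruct (clifford_zero_beyond nu (l ^ 2 / 4) hnu) as (w & hw & ew).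
  assert (hl2 := pow2_ge_0 l).
  assert (hx0 : E (2 * sqrt w)).
  { apply hE. split.
    - now apply lt_two_sqrt.
    - rewrite two_sqrt_sq by lra. exact ew. }
  assert (hglb := Glb_Rbar_correct E). unfold L.
  destruct (Glb_Rbar E) as [g| |]; simpl.
  2: { destruct hglb as [h _]. destruct (h _ hx0). }
  2: { destruct hglb as [_ h]. destruct (h l). intros x hx. apply hE in hx. simpl; lra. }
  destruct hglb as [hlow hgreat].
  assert (hlow' : forall x, l < x -> clifford nu (x ^ 2 / 4) = 0 -> g <= x).
  { intros x h1 h2. apply (hlow x). apply hE. now split. }
  assert (hgreat' : forall b, (forall x, l < x -> clifford nu (x ^ 2 / 4) = 0 -> b <= x) -> b <= g).
  { intros b h. apply (hgreat b). intros x hx. apply hE in hx. simpl. apply h; tauto. }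
  assert (hs : l < sqrt (l ^ 2 + 4 * r)).
  { rewrite <- (sqrt_pow2 l) at 1 by exact hl. apply sqrt_lt_1; lra. }
  assert (hsg : sqrt (l ^ 2 + 4 * r) <= g).
  { apply hgreat'. intros x h1 h2. assert (h := hgap x h1 h2).
    rewrite <- (sqrt_pow2 x) by lra. apply sqrt_le_1_alt. lra. }
  assert (hlg : l < g) by lra.
  assert (hz : clifford nu (g ^ 2 / 4) = 0).
  { apply NNPP. intros hne.
    assert (hc : continuous (fun x => clifford nu (x ^ 2 / 4)) g).
    { apply (continuous_comp (fun x => x ^ 2 / 4) (clifford nu)).
      - apply (ex_derive_continuous (fun x => x ^ 2 / 4)). auto_derive. exact I.
      - now apply clifford_continuous. }
    destruct (proj1 (filterlim_locally _ _) hc (mkposreal _ (Rabs_pos_lt _ hne))) as [d hd].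
    assert (hdp := cond_pos d).
    assert (g + d <= g); [|lra].
    apply hgreat'. intros x h1 h2. apply Rnot_lt_le. intros hlt.
    assert (hgx := hlow' x h1 h2).
    assert (hb : ball (clifford nu (g ^ 2 / 4)) (Rabs (clifford nu (g ^ 2 / 4))) (clifford nu (x ^ 2 / 4))).
    { apply hd. apply (proj2 (ball_Rabs _ _ _)).
      apply Rabs_lt_between; lra. }
    apply (proj1 (ball_Rabs _ _ _)) in hb. rewrite h2, Rminus_0_l, Rabs_Ropp in hb. lra. }
  repeat split; [exact hlg|exact hz|now apply hgap|].
  intros x hx e. assert (h := hlow' x (proj1 hx) e). lra.
Qed.

Lemma lambda_spec (nu : R) : -1 < nu -> exists r, 0 < r /\ forall n,
  0 <= lambda nu n /\ lambda nu n < lambda nu (S n) /\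
  clifford nu (lambda nu (S n) ^ 2 / 4) = 0 /\
  lambda nu n ^ 2 / 4 + r <= lambda nu (S n) ^ 2 / 4 /\
  (forall x, lambda nu n < x < lambda nu (S n) -> clifford nu (x ^ 2 / 4) <> 0).
Proof.
  intros hnu. destruct (clifford_zeros_gap nu hnu) as (r & hr & h0 & hgap).
  exists r. split; [exact hr|].
  induction n as [|n (h1 & h2 & h3 & h4 & h5)].
  - split; [simpl; lra|]. apply (next_zero_spec nu r 0 hnu hr (Rle_refl _)).
    intros x hx e. replace (0 ^ 2 / 4) with 0 by field.
    rewrite Rplus_0_l. apply h0; [|exact e]. assert (h := pow2_ge_0 x). lra.
  - split; [lra|]. apply (next_zero_spec nu r (lambda nu (S n)) hnu hr); [lra|].
    intros x hx e. apply hgap; [|exact h3|exact e].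
    set (l := lambda nu (S n)) in *. nra.
Qed.

Lemma lambda_growth (nu : R) : -1 < nu -> exists r, 0 < r /\ forall n,
  INR n * r <= lambda nu n ^ 2 / 4.
Proof.
  intros hnu. destruct (lambda_spec nu hnu) as (r & hr & h). exists r. split; [exact hr|].
  induction n as [|n IH].
  - simpl. lra.
  - destruct (h n) as (_ & _ & _ & h4 & _). rewrite S_INR. lra.
Qed.

(** * Bounds for the eigenfunctions *)

(** The powers of [x] and the normalisation of [Gamma] cancel in the
    eigenfunction: at an eigenvalue it only involves the ratio of [clifford nu]
    to its derivative. *)
Lemma phi_clifford (nu x : R) (n : nat) : 0 < lambda nu n -> 0 < x ->
  phi nu n x = sqrt 2 * (2 / lambda nu n)
    * (clifford nu (lambda nu n ^ 2 / 4 * x ^ 2)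
       / Rabs (clifford (nu + 1) (lambda nu n ^ 2 / 4))).
Proof.
  intros hl hx. unfold phi, dnorm. set (l := lambda nu n) in *.
  rewrite (BesselJ_clifford nu (l * x)) by now apply Rmult_lt_0_compat.
  rewrite (BesselJ_clifford (nu + 1) l) by exact hl.
  replace ((l * x) ^ 2 / 4) with (l ^ 2 / 4 * x ^ 2) by field.
  set (b := clifford nu (l ^ 2 / 4 * x ^ 2)). set (c := clifford (nu + 1) (l ^ 2 / 4)).
  rewrite !Rabs_mult.
  rewrite (Rabs_pos_eq (sqrt l)) by apply sqrt_pos.
  rewrite (Rabs_pos_eq (Rpower (l / 2) (nu + 1))) by (left; apply Rpower_pos).
  rewrite !Rinv_mult, sqrt_mult by lra.
  replace (l * x / 2) with (l / 2 * x) by field.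
  rewrite <- Rpower_mult_distr by lra.
  rewrite Rpower_plus, Rpower_1 by lra.
  assert (e : Rpower x (- nu - 1 / 2) * (sqrt x * Rpower x nu) = 1).
  { rewrite <- Rpower_sqrt by exact hx. rewrite <- !Rpower_plus.
    replace (- nu - 1 / 2 + (/ 2 + nu)) with 0 by field. now apply Rpower_O. }
  assert (hs := sqrt_lt_R0 l hl). assert (hp := Rpower_pos (l / 2) nu).
  set (ic := / Rabs c).
  transitivity (sqrt 2 * (2 / l) * (b * ic) * (Rpower x (- nu - 1 / 2) * (sqrt x * Rpower x nu))).
  - field. repeat split; lra.
  - rewrite e. unfold ic, Rdiv. ring.
Qed.

Lemma clifford_succ_bounded (nu d : R) (p : nat) : -1 < nu ->
  Rabs (2 * nu + 1) <= INR (S p) -> 0 < d ->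
  exists M, 0 < M /\ forall s z, 0 <= s <= z -> d <= z ->
    clifford (nu + 1) s ^ 2 <= M * z ^ S p.
Proof.
  intros hnu hp hd.
  destruct (continuity_ab_maj (fun s => clifford (nu + 1) s ^ 2) 0 d) as (s0 & hmax & _).
  { lra. }
  { intros s _. apply continuity_pt_filterlim.
    apply (ex_derive_continuous (fun s => clifford (nu + 1) s ^ 2)).
    eexists. apply is_derive_pow. apply clifford_derive; lra. }
  set (M0 := clifford (nu + 1) s0 ^ 2) in *.
  assert (hM0 : 0 <= M0) by apply pow2_ge_0.
  assert (hF := energy_pos nu d hnu hd).
  assert (hdp : 0 < d ^ S p) by (apply pow_lt; lra).
  exists (M0 / d ^ S p + energy nu d / d / d ^ S p).
  assert (q0 : 0 <= M0 / d ^ S p) by now apply Rdiv_le_0_compat.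
  assert (q1 : 0 < energy nu d / d / d ^ S p) by (repeat apply Rdiv_lt_0_compat; lra).
  split; [lra|]. intros s z hs hz.
  assert (hpw : forall y, 0 <= y <= z -> y ^ S p <= z ^ S p) by (intros; apply pow_incr; lra).
  assert (hzp : 0 < z ^ S p) by (apply pow_lt; lra).
  destruct (Rle_lt_dec s d) as [hsd|hsd].
  - assert (h := hmax s ltac:(lra)). simpl in h.
    assert (h1 : M0 / d ^ S p * d ^ S p <= M0 / d ^ S p * z ^ S p)
      by (apply Rmult_le_compat_l; [exact q0|apply hpw; lra]).
    replace (M0 / d ^ S p * d ^ S p) with M0 in h1 by (field; lra).
    assert (0 < energy nu d / d / d ^ S p * z ^ S p) by now apply Rmult_lt_0_compat.
    apply Rle_trans with M0; [apply hmax; lra|lra].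
  - destruct (energy_ge nu s ltac:(lra)) as [h1 _].
    assert (h2 := energy_le_mul_pow nu p d s hnu hp ltac:(lra)).
    assert (h3 : d * clifford (nu + 1) s ^ 2 <= energy nu s).
    { assert (h := pow2_ge_0 (clifford (nu + 1) s)). nra. }
    assert (h4 : clifford (nu + 1) s ^ 2 <= energy nu d / d / d ^ S p * z ^ S p).
    { apply (Rmult_le_reg_l (d * d ^ S p)); [now apply Rmult_lt_0_compat|].
      replace (d * d ^ S p * (energy nu d / d / d ^ S p * z ^ S p)) with (energy nu d * z ^ S p)
        by (field; lra).
      apply Rle_trans with (energy nu d * s ^ S p).
      - apply Rle_trans with (2 := h2).
        apply Rle_trans with (energy nu s * d ^ S p); [|lra].
        replace (d * d ^ S p * clifford (nu + 1) s ^ 2) with (d * clifford (nu + 1) s ^ 2 * d ^ S p) by ring.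
        apply Rmult_le_compat_r; lra.
      - apply Rmult_le_compat_l; [lra|apply hpw; lra]. }
    assert (0 <= M0 / d ^ S p * z ^ S p) by (apply Rmult_le_pos; lra). lra.
Qed.

(** The eigenfunctions are bounded polynomially in the eigenvalue, with the factor
    [1 - x]. That factor is the mean value theorem between [z x^2] and the zero
    [z]; in the denominator, the derivative of [clifford nu] at the zero is
    bounded below through the energy. *)
Lemma phi_bound (nu : R) : -1 < nu -> exists K (q : nat), 0 < K /\ forall n x, 0 < x < 1 ->
  Rabs (phi nu (S n) x) <= K * (lambda nu (S n) ^ 2 / 4) ^ q * (1 - x).
Proof.
  intros hnu. destruct (energy_exponent nu) as [p hp].
  destruct (lambda_spec nu hnu) as (d & hd & hl).
  destruct (clifford_succ_bounded nu d p hnu hp hd) as (M & hM & hc).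
  assert (hF := energy_pos nu d hnu hd).
  assert (hdp : 0 < d ^ S p) by (apply pow_lt; lra).
  set (K2 := 8 * M / (energy nu d * d ^ S p)).
  assert (hK2 : 0 < K2).
  { apply Rdiv_lt_0_compat; [lra|]. now apply Rmult_lt_0_compat. }
  exists (sqrt K2), (S (S p)). split; [now apply sqrt_lt_R0|].
  intros n x hx. destruct (hl n) as (l0 & l1 & l2 & l3 & _).
  rewrite phi_clifford by lra.
  set (l := lambda nu (S n)) in *.
  assert (hln := pow2_ge_0 (lambda nu n)).
  set (z := l ^ 2 / 4) in *.
  assert (hz : d <= z) by lra.
  set (c := clifford (nu + 1) z).
  assert (hzp : 0 < z ^ S p) by (apply pow_lt; lra).
  assert (hcz : energy nu d * d ^ S p <= z * c ^ 2 * z ^ S p).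
  { assert (h := energy_mul_pow_le nu p d z hnu hp ltac:(lra)).
    unfold energy in h at 2. fold c in h. rewrite l2 in h.
    replace (z * c ^ 2 + 0 ^ 2) with (z * c ^ 2) in h by ring. exact h. }
  assert (hx2 : x ^ 2 <= 1) by nra.
  assert (hx0 := pow2_ge_0 x).
  destruct (mean_value (clifford nu) (fun z => - clifford (nu + 1) z) (z * x ^ 2) z)
    as (s & hs & es).
  { nra. } { intros; now apply clifford_derive. }
  rewrite l2 in es.
  assert (hcs := hc s z ltac:(nra) hz).
  set (b := clifford nu (z * x ^ 2)) in *. set (cs := clifford (nu + 1) s) in *.
  assert (eb : b = cs * z * (1 - x ^ 2)) by lra.
  assert (hED : 0 < energy nu d * d ^ S p) by now apply Rmult_lt_0_compat.
  assert (hc0 : c <> 0).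
  { intros e. rewrite e in hcz. replace (z * 0 ^ 2 * z ^ S p) with 0 in hcz by ring. lra. }
  assert (hc2 : 0 < c ^ 2) by now apply pow2_gt_0.
  assert (el : l ^ 2 = 4 * z) by (unfold z; field).
  (* compare squares, since the energy controls b^2 and c^2 *)
  apply Rsqr_incr_0_var.
  2: { apply Rmult_le_pos; [|lra]. apply Rmult_le_pos; [apply sqrt_pos|apply pow_le; lra]. }
  rewrite <- Rsqr_abs. rewrite !Rsqr_pow2.
  replace ((sqrt 2 * (2 / l) * (b / Rabs c)) ^ 2) with (2 / z * (b ^ 2 / c ^ 2)).
  2: { rewrite <- (pow2_abs c). rewrite !Rpow_mult_distr, pow2_sqrt by lra.
       unfold Rdiv. rewrite !Rpow_mult_distr, !pow_inv, el. field.
       split; [apply Rabs_no_R0; exact hc0|lra]. }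
  replace ((sqrt K2 * z ^ S (S p) * (1 - x)) ^ 2)
    with (K2 * (z * z ^ S p) ^ 2 * (1 - x) ^ 2).
  2: { rewrite !Rpow_mult_distr, pow2_sqrt by lra. simpl. ring. }
  assert (hb2 : b ^ 2 <= M * z ^ S p * z ^ 2 * (4 * (1 - x) ^ 2)).
  { rewrite eb, !Rpow_mult_distr.
    apply Rmult_le_compat; [apply Rmult_le_pos; apply pow2_ge_0|apply pow2_ge_0| |].
    - apply Rmult_le_compat_r; [apply pow2_ge_0|exact hcs].
    - replace (4 * (1 - x) ^ 2) with ((2 * (1 - x)) ^ 2) by ring. apply pow_incr; nra. }
  apply (Rmult_le_reg_r (z * c ^ 2 * (energy nu d * d ^ S p))).
  { apply Rmult_lt_0_compat; [|exact hED]. apply Rmult_lt_0_compat; lra. }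
  replace (2 / z * (b ^ 2 / c ^ 2) * (z * c ^ 2 * (energy nu d * d ^ S p)))
    with (2 * (b ^ 2 * (energy nu d * d ^ S p))) by (field; lra).
  replace (K2 * (z * z ^ S p) ^ 2 * (1 - x) ^ 2 * (z * c ^ 2 * (energy nu d * d ^ S p)))
    with (2 * ((M * z ^ S p * z ^ 2 * (4 * (1 - x) ^ 2)) * (z * c ^ 2 * z ^ S p)))
    by (unfold K2; field; lra).
  apply Rmult_le_compat_l; [lra|].
  apply Rmult_le_compat; [apply pow2_ge_0|lra|exact hb2|exact hcz].
Qed.

Lemma clifford_pos_before_first_zero (nu z : R) : -1 < nu ->
  0 <= z < lambda nu 1 ^ 2 / 4 -> 0 < clifford nu z.
Proof.
  intros hnu hz. apply Rnot_le_lt. intros hneg.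
  destruct (lambda_spec nu hnu) as (r & hr & hl). destruct (hl 0%nat) as (_ & l1 & _ & _ & l5).
  change (lambda nu 0) with 0 in *.
  assert (h0 := clifford_0_pos nu hnu).
  destruct (IVT_gen (clifford nu) 0 z 0) as (w & hw & ew).
  { intros s. apply continuity_pt_filterlim. now apply clifford_continuous. }
  { rewrite Rmin_right, Rmax_left by lra. lra. }
  rewrite Rmin_left, Rmax_right in hw by lra.
  assert (hw0 : 0 < w).
  { destruct (proj1 hw) as [h|h]; [exact h|]. rewrite <- h in ew. lra. }
  apply (l5 (2 * sqrt w)).
  - split; [assert (h := sqrt_lt_R0 w hw0); lra|].
    apply Rnot_le_lt. intros hle.
    assert (h2 : lambda nu 1 ^ 2 <= (2 * sqrt w) ^ 2) by (apply pow_incr; lra).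
    assert (h3 := two_sqrt_sq w ltac:(lra)). lra.
  - rewrite two_sqrt_sq by lra. exact ew.
Qed.

(** [z^(nu + 1) * clifford (nu + 1) z] has derivative [z^nu * clifford nu z], so it
    is nondecreasing up to the first zero, that zero included. *)
Lemma clifford_succ_pos (nu z : R) : -1 < nu ->
  0 <= z <= lambda nu 1 ^ 2 / 4 -> 0 < clifford (nu + 1) z.
Proof.
  intros hnu hz.
  destruct (clifford_positive_near_0 (nu + 1) ltac:(lra)) as (d & hd & hpos).
  destruct (Rle_lt_dec z d) as [hzd|hzd]; [apply hpos; lra|].
  destruct (lambda_spec nu hnu) as (r & hr & hl). destruct (hl 0%nat) as (_ & _ & l2 & _ & _).
  assert (hb : forall s, 0 <= s <= lambda nu 1 ^ 2 / 4 -> 0 <= clifford nu s).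
  { intros s hs. destruct (proj2 hs) as [h|h].
    - left. apply clifford_pos_before_first_zero; [exact hnu|lra].
    - rewrite h, l2. lra. }
  assert (hm : Rpower d (nu + 1) * clifford (nu + 1) d <= Rpower z (nu + 1) * clifford (nu + 1) z).
  { apply (derive_nonneg_le (fun s => Rpower s (nu + 1) * clifford (nu + 1) s)
      (fun s => Rpower s nu * clifford nu s)); [lra| |].
    - intros s hs. evar_last.
      apply (is_derive_mult (fun s => Rpower s (nu + 1)) (clifford (nu + 1))).
      apply is_derive_Rpower; lra. apply clifford_succ_derive; lra.
      intros; apply Rmult_comm.
      unfold plus, mult; simpl. replace (nu + 1 - 1) with nu by ring.
      rewrite Rpower_plus, Rpower_1 by lra. field. lra.
    - intros s hs. apply Rmult_le_pos; [left; apply Rpower_pos|apply hb; lra]. }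
  assert (h1 := Rpower_pos z (nu + 1)).
  assert (h2 : 0 < Rpower d (nu + 1) * clifford (nu + 1) d).
  { apply Rmult_lt_0_compat; [apply Rpower_pos|apply hpos; lra]. }
  nra.
Qed.

(** By the mean value theorem again, now with the minimum of the positive function
    [clifford (nu + 1)] on [0, z]. *)
Lemma phi_1_lower (nu : R) : -1 < nu -> exists k, 0 < k /\ forall x, 0 < x < 1 ->
  k * (1 - x) <= phi nu 1 x.
Proof.
  intros hnu.
  destruct (lambda_spec nu hnu) as (r & hr & hl). destruct (hl 0%nat) as (_ & l1 & l2 & l3 & _).
  change (lambda nu 0) with 0 in *.
  set (l := lambda nu 1) in *. set (z := l ^ 2 / 4) in *.
  assert (hz : 0 < z) by lra.
  destruct (continuity_ab_min (clifford (nu + 1)) 0 z) as (s0 & hmin & hs0).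
  { lra. }
  { intros s _. apply continuity_pt_filterlim, clifford_continuous; lra. }
  set (m := clifford (nu + 1) s0) in *.
  assert (hm : 0 < m) by (apply clifford_succ_pos; assumption).
  assert (hc : 0 < clifford (nu + 1) z) by (apply clifford_succ_pos; [exact hnu|fold l z; lra]).
  assert (h2 : 0 < sqrt 2) by (apply sqrt_lt_R0; lra).
  assert (hA : 0 < sqrt 2 * (2 / l)).
  { apply Rmult_lt_0_compat; [exact h2|]. apply Rdiv_lt_0_compat; lra. }
  exists (sqrt 2 * (2 / l) * (m * z / clifford (nu + 1) z)). split.
  { apply Rmult_lt_0_compat; [exact hA|]. apply Rdiv_lt_0_compat; [|exact hc].
    now apply Rmult_lt_0_compat. }
  intros x hx. rewrite phi_clifford by (fold l; lra). fold l z.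
  rewrite (Rabs_pos_eq (clifford (nu + 1) z)) by lra.
  rewrite Rmult_assoc. apply Rmult_le_compat_l; [lra|].
  unfold Rdiv. rewrite Rmult_assoc, (Rmult_comm _ (1 - x)), <- Rmult_assoc.
  apply Rmult_le_compat_r; [left; now apply Rinv_0_lt_compat|].
  destruct (mean_value (clifford nu) (fun z => - clifford (nu + 1) z) (z * x ^ 2) z)
    as (s & hs & es).
  { assert (x ^ 2 <= 1) by nra. nra. } { intros; now apply clifford_derive. }
  rewrite l2 in es.
  assert (hms : m <= clifford (nu + 1) s).
  { apply hmin. assert (h := pow2_ge_0 x). nra. }
  replace (clifford nu (z * x ^ 2)) with (clifford (nu + 1) s * (z * (1 - x ^ 2))) by lra.
  assert (1 - x <= 1 - x ^ 2) by nra.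
  assert (z * (1 - x) <= z * (1 - x ^ 2)) by (apply Rmult_le_compat_l; lra).
  assert (0 <= z * (1 - x)) by (apply Rmult_le_pos; lra).
  rewrite Rmult_assoc. apply Rmult_le_compat; lra.
Qed.

(** * The heat kernel *)

(** Comparison with the telescoping series of [/ n - / (n + 1)]. *)
Lemma ex_series_inv_sq : ex_series (fun n => / INR (S n) ^ 2).
Proof.
  apply (ex_series_le (V := R_CompleteNormedModule)) with (b := fun n => 2 * / (INR (S n) * INR (S (S n)))).
  - intros n. assert (h := pos_INR n).
    change (norm (/ INR (S n) ^ 2)) with (Rabs (/ INR (S n) ^ 2)).
    rewrite !S_INR. rewrite Rabs_pos_eq by (left; apply Rinv_0_lt_compat, pow_lt; lra).
    apply (Rmult_le_reg_r ((INR n + 1) ^ 2 * (INR n + 1 + 1))).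
    { apply Rmult_lt_0_compat; [apply pow_lt|]; lra. }
    replace (/ (INR n + 1) ^ 2 * ((INR n + 1) ^ 2 * (INR n + 1 + 1))) with (INR n + 2) by (field; lra).
    replace (2 * / ((INR n + 1) * (INR n + 1 + 1)) * ((INR n + 1) ^ 2 * (INR n + 1 + 1)))
      with (2 * (INR n + 1)) by (field; lra).
    lra.
  - apply (ex_series_scal (V := R_NormedModule) 2).
    exists 1. change (is_lim_seq (sum_n (fun n => / (INR (S n) * INR (S (S n))))) 1).
    apply is_lim_seq_ext with (u := fun n => 1 - / INR (S (S n))).
    + intros n. induction n as [|n IH].
      * rewrite sum_O. simpl. field.
      * rewrite sum_Sn, <- IH. assert (h := pos_INR n).
        rewrite !S_INR. unfold plus; simpl. field. lra.
    + replace (Finite 1) with (Finite (1 - 0)) by (f_equal; ring).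
      apply is_lim_seq_minus'; [apply is_lim_seq_const|].
      apply (is_lim_seq_incr_1 (fun n => / INR (S n))).
      apply (is_lim_seq_incr_1 (fun n => / INR n)).
      change (Finite 0) with (Rbar_inv p_infty).
      apply is_lim_seq_inv; [apply is_lim_seq_INR|discriminate].
Qed.

Lemma pow_mul_exp_Rpower_bounded (q : nat) (T alpha : R) : 0 < T -> 0 < alpha ->
  exists C, 0 < C /\ forall l, 0 < l ->
    (l ^ 2 / 4) ^ S q * exp (- T * Rpower l alpha) <= C.
Proof.
  intros hT ha. set (p := 2 * INR (S q) / alpha).
  assert (hq : 0 < INR (S q)) by apply (lt_0_INR _ (Nat.lt_0_succ q)).
  assert (hp : 0 < p) by (apply Rdiv_lt_0_compat; lra).
  exists (exp (p * (ln (p / T) - 1))). split; [apply exp_pos|].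
  intros l hl.
  apply Rle_trans with ((l ^ 2) ^ S q * exp (- T * Rpower l alpha)).
  { apply Rmult_le_compat_r; [left; apply exp_pos|]. apply pow_incr.
    assert (h := pow2_ge_0 l). lra. }
  rewrite <- pow_mult, <- Rpower_pow by exact hl. unfold Rpower at 1. rewrite <- exp_plus.
  assert (h := mult_le_exp_shift p T (alpha * ln l) hp hT).
  apply Rle_trans with (exp (p * (alpha * ln l) - T * exp (alpha * ln l))).
  - right. f_equal. unfold Rpower, p. rewrite mult_INR. change (INR 2) with 2. field. lra.
  - destruct h as [h|h]; [left; now apply exp_increasing|right; now rewrite h].
Qed.

(** [lambda_n^2] grows at least linearly in [n] and the heat factor absorbs two
    more powers of it, so the series is dominated by that of [/ n ^ 2]. *)
Lemma ex_series_weights (nu alpha T : R) (q : nat) : -1 < nu -> 0 < alpha -> 0 < T ->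
  ex_series (fun n => (lambda nu (S n) ^ 2 / 4) ^ q
    * exp (- T * Rpower (lambda nu (S n)) alpha)).
Proof.
  intros hnu ha hT.
  destruct (pow_mul_exp_Rpower_bounded (S q) T alpha hT ha) as (C & hC & hb).
  destruct (lambda_growth nu hnu) as (r & hr & hg).
  destruct (lambda_spec nu hnu) as (r' & hr' & hl).
  apply (ex_series_le (V := R_CompleteNormedModule)) with (b := fun n => C / r ^ 2 * / INR (S n) ^ 2).
  2: { apply (ex_series_scal (V := R_NormedModule)). apply ex_series_inv_sq. }
  intros n. destruct (hl n) as (l0 & l1 & _).
  assert (hn : 0 < INR (S n)) by apply (lt_0_INR _ (Nat.lt_0_succ n)).
  assert (hbn := hb (lambda nu (S n)) ltac:(lra)).
  assert (hgn := hg (S n)).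
  set (z := lambda nu (S n) ^ 2 / 4) in *. set (e := exp (- T * Rpower (lambda nu (S n)) alpha)) in *.
  assert (he : 0 < e) by apply exp_pos.
  assert (hnr : 0 < INR (S n) * r) by now apply Rmult_lt_0_compat.
  assert (hzq : 0 < z ^ q) by (apply pow_lt; lra).
  change (norm (z ^ q * e)) with (Rabs (z ^ q * e)).
  rewrite Rabs_pos_eq by (left; now apply Rmult_lt_0_compat).
  replace (C / r ^ 2 * / INR (S n) ^ 2) with (C * / (INR (S n) * r) ^ 2) by (field; lra).
  apply (Rmult_le_reg_r ((INR (S n) * r) ^ 2)); [now apply pow_lt|].
  rewrite (Rmult_assoc C), Rinv_l, Rmult_1_r by (apply pow_nonzero; lra).
  apply Rle_trans with (2 := hbn).
  replace (z ^ S (S q) * e) with (z ^ q * e * z ^ 2) by (simpl; ring).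
  apply Rmult_le_compat_l; [left; now apply Rmult_lt_0_compat|].
  apply pow_incr; lra.
Qed.

Lemma lambda_pos (nu : R) (n : nat) : -1 < nu -> 0 < lambda nu (S n).
Proof.
  intros hnu. destruct (lambda_spec nu hnu) as (r & _ & hl).
  destruct (hl n) as (l0 & l1 & _). lra.
Qed.

Lemma lambda_le (nu : R) (j n : nat) : -1 < nu -> lambda nu j <= lambda nu (n + j).
Proof.
  intros hnu. destruct (lambda_spec nu hnu) as (r & _ & hl).
  induction n as [|n IH]; [apply Rle_refl|].
  destruct (hl (n + j)%nat) as (_ & l1 & _). rewrite Nat.add_succ_l. lra.
Qed.

Definition kernel_term (nu alpha t x y : R) (n : nat) : R :=
  exp (- t * Rpower (lambda nu (S n)) alpha) * phi nu (S n) x * phi nu (S n) y.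

(** In the terms of index at least [j], [exp (- t w_n)] is at most
    [exp (- (t - T) w_j) * exp (- T w_n)]: the first factor gives the decay in
    [t], and the second makes the series converge, uniformly in [t], [x] and [y].
    The case [j = 0] bounds the whole kernel; [j = 1] bounds what is left after
    the leading term, by an exponential that decays faster. *)
Lemma kernel_tail_bound (nu alpha T : R) (j : nat) : -1 < nu -> 0 < alpha -> 0 < T ->
  exists D, 0 < D /\ forall t x y, 0 < x < 1 -> 0 < y < 1 -> T <= t ->
    ex_series (fun n => kernel_term nu alpha t x y (n + j)) /\
    Rabs (Series (fun n => kernel_term nu alpha t x y (n + j)))
    <= D * ((1 - x) * (1 - y) * exp (- t * Rpower (lambda nu (S j)) alpha)).
Proof.
  intros hnu ha hT. destruct (phi_bound nu hnu) as (K & q & hK & hb).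
  set (w := fun n => Rpower (lambda nu (S n)) alpha).
  set (W := fun n => (lambda nu (S n) ^ 2 / 4) ^ (q + q) * exp (- T * w n)).
  assert (hW : ex_series (fun n => W (n + j)%nat)).
  { apply (ex_series_ext (V := R_NormedModule)) with (a := fun n => W (j + n)%nat).
    { intros n. now rewrite Nat.add_comm. }
    apply (ex_series_incr_n (V := R_NormedModule) W j).
    now apply ex_series_weights. }
  set (D := K ^ 2 * exp (T * w j)).
  assert (hD : 0 < D) by (apply Rmult_lt_0_compat; [now apply pow_lt|apply exp_pos]).
  assert (hWs : 0 <= Series (fun n => W (n + j)%nat)).
  { rewrite <- (Rmult_0_l (Series (fun n => W (n + j)%nat))), <- Series_scal_l. apply Series_le; [|exact hW].
    intros n. rewrite Rmult_0_l. split; [apply Rle_refl|]. unfold W. apply Rmult_le_pos; [|left; apply exp_pos].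
    apply pow_le. assert (h := pow2_ge_0 (lambda nu (S (n + j)))). lra. }
  exists (D * (Series (fun n => W (n + j)%nat) + 1)). split; [apply Rmult_lt_0_compat; lra|].
  intros t x y hx hy ht.
  set (P := (1 - x) * (1 - y)).
  assert (hP : 0 < P) by (apply Rmult_lt_0_compat; lra).
  assert (hterm : forall n, Rabs (kernel_term nu alpha t x y (n + j))
    <= D * (P * exp (- t * w j)) * W (n + j)%nat).
  { intros n. set (m := (n + j)%nat).
    assert (h1 := hb m x hx). assert (h2 := hb m y hy).
    unfold kernel_term. fold (w m). rewrite !Rabs_mult, (Rabs_pos_eq (exp _)) by (left; apply exp_pos).
    unfold W, D. set (z := lambda nu (S m) ^ 2 / 4) in *.
    assert (hw : w j <= w m).
    { unfold w. apply Rle_Rpower_l; [lra|]. split; [now apply lambda_pos|].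
      unfold m. rewrite <- (Nat.add_succ_r n j). now apply lambda_le. }
    assert (he : exp (- t * w m) <= exp (T * w j) * exp (- t * w j) * exp (- T * w m)).
    { rewrite <- !exp_plus.
      assert (h : - t * w m <= T * w j + - t * w j + - T * w m) by nra.
      destruct h as [h|h]; [left; now apply exp_increasing|right; now rewrite h]. }
    rewrite pow_add.
    replace (K ^ 2 * exp (T * w j) * (P * exp (- t * w j)) * (z ^ q * z ^ q * exp (- T * w m)))
      with (exp (T * w j) * exp (- t * w j) * exp (- T * w m) * (K * z ^ q * (1 - x)) * (K * z ^ q * (1 - y)))
      by (unfold P; ring).
    apply Rmult_le_compat; [|apply Rabs_pos| |exact h2].
    - apply Rmult_le_pos; [left; apply exp_pos|apply Rabs_pos].
    - apply Rmult_le_compat; [left; apply exp_pos|apply Rabs_pos|exact he|exact h1]. }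
  assert (hdom : ex_series (fun n => D * (P * exp (- t * w j)) * W (n + j)%nat)).
  { now apply (ex_series_scal (V := R_NormedModule)). }
  assert (habs : ex_series (fun n => Rabs (kernel_term nu alpha t x y (n + j)))).
  { apply (ex_series_le (V := R_CompleteNormedModule)) with (2 := hdom).
    intros n. change (norm (Rabs (kernel_term nu alpha t x y (n + j))))
      with (Rabs (Rabs (kernel_term nu alpha t x y (n + j)))).
    rewrite Rabs_Rabsolu. apply hterm. }
  split; [now apply ex_series_Rabs|].
  apply Rle_trans with (1 := Series_Rabs _ habs).
  apply Rle_trans with (Series (fun n => D * (P * exp (- t * w j)) * W (n + j)%nat)).
  { apply Series_le; [|exact hdom]. intros n. split; [apply Rabs_pos|apply hterm]. }
  rewrite Series_scal_l. fold (w j).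
  assert (0 <= D * (P * exp (- t * w j))).
  { apply Rmult_le_pos; [lra|]. apply Rmult_le_pos; [lra|left; apply exp_pos]. }
  replace (D * (Series (fun n => W (n + j)%nat) + 1) * (P * exp (- t * w j)))
    with (D * (P * exp (- t * w j)) * Series (fun n => W (n + j)%nat) + D * (P * exp (- t * w j))) by ring.
  lra.
Qed.

Lemma G_kernel_term (nu alpha t x y : R) :
  G nu alpha t x y = Series (fun n => kernel_term nu alpha t x y (n + 0)).
Proof. apply Series_ext. intros n. now rewrite Nat.add_0_r. Qed.

Lemma G_upper (nu alpha T : R) : -1 < nu -> 0 < alpha -> 0 < T ->
  exists C, 0 < C /\ forall x y t, 0 < x < 1 -> 0 < y < 1 -> T <= t ->
    G nu alpha t x y <= C * (1 - x) * (1 - y) * exp (- t * Rpower (lambda nu 1) alpha).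
Proof.
  intros hnu ha hT. destruct (kernel_tail_bound nu alpha T 0 hnu ha hT) as (D & hD & hb).
  exists D. split; [exact hD|]. intros x y t hx hy ht.
  destruct (hb t x y hx hy ht) as [_ h]. rewrite <- G_kernel_term in h.
  apply Rabs_le_between in h. lra.
Qed.

(** The leading term is at least [k^2 (1 - x) (1 - y) exp (- t w0)], and the tail is
    at most half of it from some time on since [w0 < w1]. *)
Lemma G_lower (nu alpha : R) : -1 < nu -> 0 < alpha ->
  exists T c, 0 < T /\ 0 < c /\ forall x y t, 0 < x < 1 -> 0 < y < 1 -> T <= t ->
    c * (1 - x) * (1 - y) * exp (- t * Rpower (lambda nu 1) alpha) <= G nu alpha t x y.
Proof.
  intros hnu ha. destruct (phi_1_lower nu hnu) as (k & hk & hphi).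
  destruct (kernel_tail_bound nu alpha 1 0 hnu ha Rlt_0_1) as (D0 & _ & hb0).
  destruct (kernel_tail_bound nu alpha 1 1 hnu ha Rlt_0_1) as (D & hD & hb).
  set (w0 := Rpower (lambda nu 1) alpha) in *. set (w1 := Rpower (lambda nu 2) alpha) in *.
  assert (hw : w0 < w1).
  { apply Rlt_Rpower_l; [exact ha|]. split; [now apply lambda_pos|].
    destruct (lambda_spec nu hnu) as (r & _ & hl). apply (hl 1%nat). }
  set (T0 := ln (2 * D / k ^ 2) / (w1 - w0)).
  exists (Rmax 1 T0), (k ^ 2 / 2).
  assert (hk2 : 0 < k ^ 2) by now apply pow_lt.
  split; [apply Rlt_le_trans with (1 := Rlt_0_1), Rmax_l|]. split; [lra|].
  intros x y t hx hy ht.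
  assert (ht1 : 1 <= t) by (apply Rle_trans with (2 := ht), Rmax_l).
  assert (ht0 : T0 <= t) by (apply Rle_trans with (2 := ht), Rmax_r).
  rewrite G_kernel_term. destruct (hb0 t x y hx hy ht1) as [hex _].
  destruct (hb t x y hx hy ht1) as [_ htail].
  rewrite Series_incr_1 by exact hex.
  set (tail := Series (fun n => kernel_term nu alpha t x y (n + 1))) in *.
  replace (Series (fun n => kernel_term nu alpha t x y (S n + 0))) with tail.
  2: { apply Series_ext. intros n. f_equal. lia. }
  unfold kernel_term. simpl Nat.add. fold w0.
  set (P := (1 - x) * (1 - y)) in *.
  assert (hP : 0 < P) by (apply Rmult_lt_0_compat; lra).
  assert (hlead : exp (- t * w0) * (k ^ 2 * P) <= exp (- t * w0) * phi nu 1 x * phi nu 1 y).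
  { rewrite Rmult_assoc. apply Rmult_le_compat_l; [left; apply exp_pos|].
    replace (k ^ 2 * P) with (k * (1 - x) * (k * (1 - y))) by (unfold P; ring).
    assert (0 <= k * (1 - x)) by (apply Rmult_le_pos; lra).
    assert (0 <= k * (1 - y)) by (apply Rmult_le_pos; lra).
    apply Rmult_le_compat; [assumption|assumption|now apply hphi|now apply hphi]. }
  assert (hgap : D * exp (- t * w1) <= k ^ 2 / 2 * exp (- t * w0)).
  { assert (hr : 0 < 2 * D / k ^ 2) by (apply Rdiv_lt_0_compat; lra).
    assert (hT0 : ln (2 * D / k ^ 2) <= t * (w1 - w0)).
    { replace (ln (2 * D / k ^ 2)) with (T0 * (w1 - w0)) by (unfold T0; field; lra).
      apply Rmult_le_compat_r; lra. }
    assert (he : 2 * D / k ^ 2 <= exp (t * (w1 - w0))).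
    { rewrite <- (exp_ln (2 * D / k ^ 2)) by exact hr.
      destruct hT0 as [h|h]; [left; now apply exp_increasing|right; now rewrite h]. }
    assert (ee : exp (- t * w0) = exp (t * (w1 - w0)) * exp (- t * w1)).
    { rewrite <- exp_plus. f_equal. ring. }
    rewrite ee, <- Rmult_assoc. apply Rmult_le_compat_r; [left; apply exp_pos|].
    replace D with (k ^ 2 / 2 * (2 * D / k ^ 2)) by (field; lra).
    apply Rmult_le_compat_l; lra. }
  apply Rabs_le_between in htail.
  assert (D * (P * exp (- t * w1)) <= P * (k ^ 2 / 2 * exp (- t * w0))).
  { replace (D * (P * exp (- t * w1))) with (P * (D * exp (- t * w1))) by ring.
    apply Rmult_le_compat_l; lra. }
  replace (k ^ 2 / 2 * (1 - x) * (1 - y) * exp (- t * w0))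
    with (exp (- t * w0) * (k ^ 2 * P) - P * (k ^ 2 / 2 * exp (- t * w0))) by (unfold P; field).
  lra.
Qed.

Theorem theorem3p7 (nu alpha : R) (hnu : -1 < nu) (halpha : 0 < alpha <= 2) :
  (exists T C : R, 0 < T /\ 1 <= C /\
     forall x y t : R, 0 < x < 1 -> 0 < y < 1 -> T <= t ->
       / C * (1 - x) * (1 - y) * exp (- t * Rpower (lambda nu 1) alpha)
         <= G nu alpha t x y
         <= C * (1 - x) * (1 - y) * exp (- t * Rpower (lambda nu 1) alpha))
  /\
  (forall T : R, 0 < T ->
     exists CT : R,
       forall x y t : R, 0 < x < 1 -> 0 < y < 1 -> T <= t ->
         G nu alpha t x y
         <= CT * (1 - x) * (1 - y) * exp (- t * Rpower (lambda nu 1) alpha)).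
Proof.
  destruct halpha as [ha _]. split.
  - destruct (G_lower nu alpha hnu ha) as (T & c & hT & hc & hlow).
    destruct (G_upper nu alpha T hnu ha hT) as (C & hC & hup).
    set (M := Rmax 1 (Rmax C (/ c))).
    assert (h1 : 1 <= M) by apply Rmax_l.
    assert (h2 : C <= M) by (apply Rle_trans with (2 := Rmax_r _ _), Rmax_l).
    assert (h3 : / c <= M) by (apply Rle_trans with (2 := Rmax_r _ _), Rmax_r).
    exists T, M. split; [exact hT|]. split; [exact h1|].
    intros x y t hx hy ht.
    assert (hmono : forall a b, a <= b ->
      a * (1 - x) * (1 - y) * exp (- t * Rpower (lambda nu 1) alpha)
      <= b * (1 - x) * (1 - y) * exp (- t * Rpower (lambda nu 1) alpha)).
    { intros a b hab. apply Rmult_le_compat_r; [left; apply exp_pos|].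
      apply Rmult_le_compat_r; [lra|]. apply Rmult_le_compat_r; lra. }
    split.
    + apply Rle_trans with (2 := hlow x y t hx hy ht). apply hmono.
      rewrite <- (Rinv_inv c). apply Rinv_le_contravar; [now apply Rinv_0_lt_compat|exact h3].
    + apply Rle_trans with (1 := hup x y t hx hy ht). now apply hmono.
  - intros T hT. destruct (G_upper nu alpha T hnu ha hT) as (C & _ & hup). now exists C.
Qed.
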